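(* Assume $\kappa=\kappa^{<\kappa}$. For every $x\in S_\kappa$, the Stone–Čech remainder $(S_\kappa\setminus\{x\})^*$ contains a family of $2^\kappa$ many pairwise disjoint non-empty clopen sets.
   Context: A space is zero-dimensional if it has a base of clopen sets. For a zero-dimensional space $X$ and an open $U\subseteq X$, the ($X$-)type $\tau(U)$ is the least cardinal $\tau$ such that $U$ is a union of $\tau$ many clopen subsets of $X$. A zero-dimensional space is an $F_\kappa$-space if every open subset of type less than $\kappa$ is $C^*$-embedded (every bounded continuous real-valued function on it extends continuously to the whole space). A space is a $G_\kappa$-space if every non-empty intersection of fewer than $\kappa$ open sets has non-empty interior. A $\kappa$-Parovičenko space is a compact Hausdorff zero-dimensional $F_\kappa$- and $G_\kappa$-space without isolated points (no weight restriction is imposed). If $\kappa=\kappa^{<\kappa}$ there is, up to homeomorphism, a unique $\kappa$-Parovičenko space of weight $\kappa$; it is denoted $S_\kappa$. For a Tychonoff space $X$, $X^*=\beta X\setminus X$. *)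

(* Defs.v *)
From Stdlib Require Import Reals List.
Open Scope R_scope.

Definition card_le (A B : Type) : Prop :=
  exists f : A -> B, forall a1 a2, f a1 = f a2 -> a1 = a2.
Definition card_lt (A B : Type) : Prop := card_le A B /\ ~ card_le B A.

Record Top : Type := mkTop {
  carrier :> Type;
  isopen : (carrier -> Prop) -> Prop;
  open_full : isopen (fun _ => True);
  open_inter : forall U V, isopen U -> isopen V -> isopen (fun x => U x /\ V x);
  open_union : forall F : (carrier -> Prop) -> Prop,
      (forall U, F U -> isopen U) -> isopen (fun x => exists U, F U /\ U x)
}.
Arguments isopen {t} _.

Definition isclosed {X : Top} (C : X -> Prop) : Prop := isopen (fun x => ~ C x).
Definition isclopen {X : Top} (C : X -> Prop) : Prop := isopen C /\ isclosed C.

Definition compact (X : Top) : Prop :=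
  forall (I : Type) (U : I -> X -> Prop),
    (forall i, isopen (U i)) -> (forall x, exists i, U i x) ->
    exists l : list I, forall x, exists i, In i l /\ U i x.

Definition hausdorff (X : Top) : Prop :=
  forall x y : X, x <> y -> exists U V, isopen U /\ isopen V /\ U x /\ V y /\
     (forall z, U z -> V z -> False).

Definition is_base {X : Top} {I : Type} (b : I -> X -> Prop) : Prop :=
  (forall i, isopen (b i)) /\
  (forall U x, isopen U -> U x -> exists i, b i x /\ forall y, b i y -> U y).

Definition zero_dimensional (X : Top) : Prop :=
  exists (I : Type) (b : I -> X -> Prop), is_base b /\ forall i, isclopen (b i).

Definition weight_is (K : Type) (X : Top) : Prop :=
  (exists b : K -> X -> Prop, is_base b) /\
  (forall (I : Type) (b : I -> X -> Prop), is_base b -> card_le K I).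

Definition no_isolated_points (X : Top) : Prop :=
  forall x : X, ~ isopen (fun y => y = x).

Definition Ropen (V : R -> Prop) : Prop :=
  forall x, V x -> exists e, e > 0 /\ forall y, Rabs (y - x) < e -> V y.

Definition rcont_on {X : Top} (A : X -> Prop) (f : X -> R) : Prop :=
  forall V, Ropen V -> exists W, isopen W /\ forall x, A x -> (W x <-> V (f x)).

Definition bounded_on {X : Type} (A : X -> Prop) (f : X -> R) : Prop :=
  exists M, forall x, A x -> Rabs (f x) <= M.

Definition Cstar_embedded {X : Top} (A : X -> Prop) : Prop :=
  forall f : X -> R, bounded_on A f -> rcont_on A f ->
    exists g : X -> R, rcont_on (fun _ => True) g /\ forall x, A x -> g x = f x.

(* ---------- kappa-notions (kappa given as the cardinality of a type K) ---------- *)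
Definition type_lt (K : Type) {X : Top} (U : X -> Prop) : Prop :=
  exists (I : Type) (c : I -> X -> Prop), card_lt I K /\
    (forall i, isclopen (c i)) /\ (forall x, U x <-> exists i, c i x).

Definition F_kappa (K : Type) (X : Top) : Prop :=
  forall U : X -> Prop, isopen U -> type_lt K U -> Cstar_embedded U.

Definition G_kappa (K : Type) (X : Top) : Prop :=
  forall (I : Type) (o : I -> X -> Prop), card_lt I K -> (forall i, isopen (o i)) ->
    (exists x, forall i, o i x) ->
    exists W, isopen W /\ (exists y, W y) /\ forall y, W y -> forall i, o i y.

Definition kappa_Parovicenko (K : Type) (X : Top) : Prop :=
  compact X /\ hausdorff X /\ zero_dimensional X /\ F_kappa K X /\ G_kappa K X /\
  no_isolated_points X.

(* kappa = kappa^{<kappa}  (for infinite kappa): kappa^lambda <= kappa for all lambda < kappa *)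
Definition kappa_eq_kappa_lt_kappa (K : Type) : Prop :=
  forall I : Type, card_lt I K -> card_le (I -> K) K.

Definition embedding_on {X Y : Top} (A : X -> Prop) (e : X -> Y) : Prop :=
  (forall a1 a2, A a1 -> A a2 -> e a1 = e a2 -> a1 = a2) /\
  (forall V, isopen V -> exists W, isopen W /\ forall x, A x -> (W x <-> V (e x))) /\
  (forall W, isopen W -> exists V, isopen V /\ forall x, A x -> (W x <-> V (e x))).

Definition image_of {X Y : Type} (A : X -> Prop) (e : X -> Y) : Y -> Prop :=
  fun y => exists a, A a /\ e a = y.

Definition stone_cech_of {X : Top} (A : X -> Prop) (B : Top) (e : X -> B) : Prop :=
  compact B /\ hausdorff B /\ embedding_on A e /\
  (forall V, isopen V -> (exists b, V b) -> exists a, A a /\ V (e a)) /\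
  Cstar_embedded (image_of A e).

Definition remainder {X : Top} (A : X -> Prop) {B : Top} (e : X -> B) : B -> Prop :=
  fun b => ~ image_of A e b.

Definition clopen_in {Y : Top} (R C : Y -> Prop) : Prop :=
  (forall y, C y -> R y) /\
  (exists V, isopen V /\ forall y, R y -> (C y <-> V y)) /\
  (exists V, isopen V /\ forall y, R y -> (~ C y <-> V y)).

(* Main.v *)
Require Import Defs.
From Stdlib Require Import Reals List Arith Lia Lra Classical ClassicalEpsilon FunctionalExtensionality PropExtensionality.
From Stdlib Require Import Relation_Operators Lexicographic_Product.
From mathcomp Require wochoice boolp.

(* Call an open set small if it is a union of fewer than kappa clopen sets; disjoint small open sets are separated by a clopen set. It suffices to find 2^kappa clopen subsets W_f (f in 2^kappa) of S \ {x}, each accumulating at x, any two of which meet in a set bounded away from x: their closures in the Stone-Cech compactification then trace disjoint non-empty clopen sets on the remainder.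

   Choose a small open U0 whose closure, but not U0 itself, contains x, or U0 empty if there is none. In both cases every small open set missing x and U0 lies in a clopen set missing x. Cover S \ {x} by clopen sets C_a (a < kappa), where each C_a contains a clopen E_a disjoint from U0 and from all earlier C_b, and E_a contains kappa many disjoint non-empty clopen pieces. The set W_f /\ C_a is chosen by recursion on a and, for fixed a, on the at most kappa restrictions f|a: it is disjoint from U0, extends W_f /\ C_b for b < a, meets E_a in the piece reserved for f|a, and meets the sets already chosen for other g|a only inside a clopen set missing x which depends only on f restricted to the first place where f and g differ. The conditions involve two disjoint small open sets, so separation applies. *)

(** * Extensionality and well-orderings *)

Lemma pred_ext (A : Type) (P Q : A -> Prop) : (forall a, P a <-> Q a) -> P = Q.
Proof.
  intros H; extensionality a; apply propositional_extensionality, H.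
Qed.

Tactic Notation "rewrite_pred" uconstr(Q) :=
  match goal with |- _ ?P => rewrite (pred_ext _ P Q) end.

(** Zermelo's theorem, with [wochoice] supplying a unique least element for every non-empty subset.
    The order axioms are read off from the least elements of sets of two or three points. *)
Lemma well_order_exists (T : Type) :
  exists lt : T -> T -> Prop,
    well_founded lt /\ (forall a b c, lt a b -> lt b c -> lt a c) /\
    (forall a b, lt a b \/ a = b \/ lt b a).
Proof.
  destruct (wochoice.well_ordering_principle
    (boolp.boolp_classicType__canonical__eqtype_Equality T)) as [r Hr].
  set (le := fun a b : T => r a b = true).
  assert (min : forall A : T -> Prop, (exists a, A a) ->
     exists m, A m /\ (forall a, A a -> le m a) /\
       forall m', A m' -> (forall a, A a -> le m' a) -> m = m').
  { intros A [a Aa].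
    set (A' := fun t : T => if excluded_middle_informative (A t) then true else false).
    assert (HA : forall t, A' t = true <-> A t)
      by (intros t; unfold A'; destruct excluded_middle_informative; easy).
    destruct (Hr A') as [m [[Am Lm] Um]].
    { exists a. apply HA, Aa. }
    exists m. split; [now apply HA|split].
    - intros b Ab. apply Lm. now apply HA.
    - intros m' Am' Lm'. apply Um. split; [now apply HA|].
      intros b Ab. apply Lm'. now apply HA. }
  clearbody le; clear r Hr.
  assert (le_total : forall a b, le a b \/ le b a).
  { intros a b. destruct (min (fun t => t = a \/ t = b)) as [m [[->| ->] [Lm _]]]; eauto. }
  assert (le_anti : forall a b, le a b -> le b a -> a = b).
  { intros a b ab ba.
    assert (refl : forall t, le t t) by (intros t; destruct (le_total t t); easy).
    destruct (min (fun t => t = a \/ t = b)) as [m [_ [_ Um]]]; eauto.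
    transitivity m; [symmetry|]; apply Um; auto; intros t [->| ->]; auto. }
  exists (fun a b => ~ le b a). split; [|split].
  - intros a. apply NNPP; intros Na.
    destruct (min (fun t => ~ Acc (fun a b => ~ le b a) t)) as [m [Am [Lm _]]]; eauto.
    apply Am. constructor. intros t Ht. apply NNPP. auto.
  - intros a b c ab bc ca.
    destruct (min (fun t => t = a \/ t = b \/ t = c)) as [m [Em [Lm _]]]; eauto.
    destruct Em as [->|[->| ->]].
    + assert (a = c) by auto. subst c. auto.
    + auto.
    + auto.
  - intros a b. destruct (classic (le b a)), (classic (le a b)); auto.
Qed.

(** * Cardinals below K *)

Lemma card_le_trans (A B C : Type) : card_le A B -> card_le B C -> card_le A C.
Proof.
  intros [f Hf] [g Hg]. exists (fun a => g (f a)). auto.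
Qed.

Lemma card_lt_of_le (A B K : Type) : card_le A B -> card_lt B K -> card_lt A K.
Proof.
  intros AB [BK NKB]. split; [now apply card_le_trans with B|].
  intros KA. apply NKB. now apply card_le_trans with A.
Qed.

Lemma card_le_sig (A : Type) (P : A -> Prop) : card_le {a | P a} A.
Proof.
  exists (@proj1_sig A P). intros [a Pa] [b Pb] E. simpl in E. subst b.
  f_equal. apply proof_irrelevance.
Qed.

Lemma not_card_lt_subset (K : Type) (P : K -> Prop) :
  ~ card_lt {k | P k} K -> card_le K {k | P k}.
Proof.
  intros H. apply NNPP. intros N. apply H. split; [apply card_le_sig|exact N].
Qed.

(** Take the least [a] whose initial segment is not smaller than [K]. That segment receives an
    injection from [K], and the order is pulled back along it: new segments embed in segments of
    points below [a]. *)
Lemma initial_well_order_exists (K : Type) :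
  exists lt : K -> K -> Prop,
    well_founded lt /\ (forall a b c, lt a b -> lt b c -> lt a c) /\
    (forall a b, lt a b \/ a = b \/ lt b a) /\
    (forall a, card_lt {b | lt b a} K).
Proof.
  destruct (well_order_exists K) as [lt [wf [tr tot]]].
  destruct (classic (forall a, card_lt {b | lt b a} K)) as [small|N]; [now exists lt|].
  apply not_all_ex_not in N.
  assert (exists a, ~ card_lt {b | lt b a} K /\
                    forall c, lt c a -> card_lt {b | lt b c} K) as [a [Na Ma]].
  { destruct N as [a Na]. induction (wf a) as [a _ IH].
    destruct (classic (forall c, lt c a -> card_lt {b | lt b c} K)) as [H|H]; [eauto|].
    apply not_all_ex_not in H. destruct H as [c Hc].
    apply imply_to_and in Hc. destruct Hc. eauto. }
  destruct (not_card_lt_subset _ _ Na) as [j Hj].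
  pose (v := fun k => proj1_sig (j k)).
  assert (Hv : forall k l, v k = v l -> k = l).
  { intros k l E. apply Hj. revert E. unfold v. destruct (j k), (j l). simpl.
    intros; subst; f_equal; apply proof_irrelevance. }
  exists (fun k l => lt (v k) (v l)). split; [|split; [|split]].
  -
    intros k. remember (v k) as t eqn:E. revert k E.
    induction (wf t) as [t _ IH]. intros k ->. constructor. intros l Hl. eapply IH; eauto.
  - eauto.
  - intros k l. destruct (tot (v k) (v l)) as [H|[H|H]]; auto.
  - intros k. apply card_lt_of_le with {b | lt b (v k)}.
    + exists (fun l : {l | lt (v l) (v k)} => exist (fun b => lt b (v k)) (v (proj1_sig l)) (proj2_sig l)).
      intros [l Hl] [m Hm] E. apply (f_equal (@proj1_sig _ _)) in E. simpl in E.
      apply Hv in E. subst m. f_equal. apply proof_irrelevance.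
    + apply Ma. exact (proj2_sig (j k)).
Qed.

Section SmallCardinals.
Context (K : Type) (K_inf : card_le nat K) (K_pow : kappa_eq_kappa_lt_kappa K).

Lemma finite_lt (n : nat) : card_lt {m | m < n}%nat K.
Proof.
  split.
  - apply card_le_trans with nat; [apply card_le_sig|exact K_inf].
  - intros H. destruct (card_le_trans _ _ _ K_inf H) as [f Hf].
    pose (l := map (fun m => proj1_sig (f m)) (seq 0 (S n))).
    assert (Nl : NoDup l).
    { unfold l. apply NoDup_map_NoDup_ForallPairs; [|apply seq_NoDup].
      intros a b _ _ E. apply Hf. destruct (f a), (f b). simpl in E. subst.
      f_equal. apply proof_irrelevance. }
    apply NoDup_incl_length with (l' := seq 0 n) in Nl.
    + unfold l in Nl. rewrite length_map, !length_seq in Nl. lia.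
    + intros m Hm. unfold l in Hm. apply in_map_iff in Hm. destruct Hm as [i [<- _]].
      apply in_seq. destruct (f i). simpl. lia.
Qed.

Lemma bool_lt : card_lt bool K.
Proof.
  apply card_lt_of_le with {m | m < 2}%nat; [|apply finite_lt].
  exists (fun b : bool => if b then exist (fun m => m < 2)%nat 0%nat (Nat.lt_0_succ 1)
                          else exist (fun m => m < 2)%nat 1%nat (Nat.lt_succ_diag_r 1)).
  intros [] [] E; try easy; apply (f_equal (@proj1_sig _ _)) in E; easy.
Qed.

Lemma unit_lt : card_lt unit K.
Proof.
  apply card_lt_of_le with bool; [|apply bool_lt].
  exists (fun _ => true). now intros [] [].
Qed.

(* König's diagonal argument: K^I <= K makes K regular. *)
Lemma sigma_lt (I : Type) (J : I -> Type) :
  card_lt I K -> (forall i, card_lt (J i) K) -> card_lt {i & J i} K.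
Proof.
  intros HI HJ. split.
  - apply card_le_trans with (bool -> K); [|apply K_pow, bool_lt].
    destruct HI as [[f Hf] _].
    pose (g := fun i => constructive_indefinite_description _ (proj1 (HJ i))).
    exists (fun p b => if b : bool then f (projT1 p) else proj1_sig (g (projT1 p)) (projT2 p)).
    intros [i a] [j b] E.
    pose proof (equal_f E true) as E1; pose proof (equal_f E false) as E2; simpl in *.
    apply Hf in E1. subst j. destruct (g i) as [h Hh]. simpl in E2.
    apply Hh in E2. now subst.
  - intros H. destruct (card_le_trans _ _ _ (K_pow I HI) H) as [h Hh].
    assert (Hk : forall i, exists k, forall j w, h w = existT J i j -> w i <> k).
    { intros i. apply NNPP; intros N. apply (proj2 (HJ i)).
      destruct (choice (fun k (p : J i * (I -> K)) =>
        h (snd p) = existT J i (fst p) /\ snd p i = k)) as [p Hp].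
      - intros k. apply NNPP; intros Nk. apply N. exists k. intros j w E Ew.
        apply Nk. now exists (j, w).
      - exists (fun k => fst (p k)). intros k l E.
        destruct (Hp k) as [Pk <-], (Hp l) as [Pl <-].
        rewrite E, <- Pl in Pk. now rewrite (Hh _ _ Pk). }
    destruct (choice _ Hk) as [w Hw].
    destruct (h w) as [i j] eqn:E. exact (Hw i j w E eq_refl).
Qed.

Lemma sum_lt (I J : Type) : card_lt I K -> card_lt J K -> card_lt (I + J) K.
Proof.
  intros HI HJ.
  apply card_lt_of_le with {b : bool & if b then I else J}.
  - exists (fun s => match s with
      | inl i => existT (fun b : bool => if b then I else J) true i
      | inr j => existT (fun b : bool => if b then I else J) false j end).
    intros [i|i] [j|j] E; try easy; f_equal; now apply inj_pair2 in E.
  - apply sigma_lt; [apply bool_lt|now intros []].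
Qed.

End SmallCardinals.

(** * Small open sets *)

Lemma open_ext {X : Top} (U V : X -> Prop) : (forall x, U x <-> V x) -> isopen U -> isopen V.
Proof. intros H. now rewrite (pred_ext _ _ _ H). Qed.

Lemma open_Union {X : Top} (I : Type) (U : I -> X -> Prop) :
  (forall i, isopen (U i)) -> isopen (fun x => exists i, U i x).
Proof.
  intros H. apply open_ext with (fun x => exists V, (exists i, V = U i) /\ V x).
  - intros x; split.
    + intros [V [[i ->] Hx]]; eauto.
    + intros [i Hx]; eauto.
  - apply open_union. now intros V [i ->].
Qed.

Lemma open_empty (X : Top) : isopen (fun _ : X => False).
Proof.
  apply open_ext with (fun x : X => exists i : Empty_set, False).
  - intros x; split; [now intros [[] _]|easy].
  - apply open_Union. easy.
Qed.

Lemma open_or {X : Top} (U V : X -> Prop) : isopen U -> isopen V -> isopen (fun x => U x \/ V x).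
Proof.
  intros HU HV. apply open_ext with (fun x => exists b : bool, (if b then U else V) x).
  - intros x; split.
    + intros [[] H]; auto.
    + intros [H|H]; [now exists true|now exists false].
  - apply open_Union. now intros [].
Qed.

Lemma open_and_const {X : Top} (P : Prop) (U : X -> Prop) : isopen U -> isopen (fun x => P /\ U x).
Proof.
  intros HU. apply open_ext with (fun x => exists _ : P, U x); [firstorder|].
  now apply open_Union.
Qed.

Lemma open_local {X : Top} (U : X -> Prop) :
  (forall x, U x -> exists V, isopen V /\ V x /\ forall y, V y -> U y) -> isopen U.
Proof.
  intros H. apply open_ext with (fun x => exists V, (isopen V /\ forall y, V y -> U y) /\ V x).
  - intros x; split; [firstorder|].
    intros Ux. destruct (H x Ux) as [V HV]. exists V. tauto.
  - apply open_union. tauto.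
Qed.

Lemma clopen_not {X : Top} (C : X -> Prop) : isclopen C -> isclopen (fun x => ~ C x).
Proof.
  intros [H1 H2]. split; [exact H2|]. apply open_ext with C; [|exact H1].
  intros x; split; [tauto|apply NNPP].
Qed.

Lemma clopen_and {X : Top} (C D : X -> Prop) :
  isclopen C -> isclopen D -> isclopen (fun x => C x /\ D x).
Proof.
  intros [H1 H2] [H3 H4]. split; [now apply open_inter|].
  apply open_ext with (fun x => ~ C x \/ ~ D x); [|now apply open_or].
  intros x; tauto.
Qed.

Lemma clopen_or {X : Top} (C D : X -> Prop) :
  isclopen C -> isclopen D -> isclopen (fun x => C x \/ D x).
Proof.
  intros [H1 H2] [H3 H4]. split; [now apply open_or|].
  apply open_ext with (fun x => ~ C x /\ ~ D x); [|now apply open_inter].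
  intros x; tauto.
Qed.

Lemma clopen_empty (X : Top) : isclopen (fun _ : X => False).
Proof.
  split; [apply open_empty|]. apply open_ext with (fun _ : X => True); [tauto|apply open_full].
Qed.

Lemma clopen_list_or {X : Top} (I : Type) (C : I -> X -> Prop) (l : list I) :
  (forall i, isclopen (C i)) -> isclopen (fun x => exists i, In i l /\ C i x).
Proof.
  intros HC. induction l as [|i l IH].
  - rewrite_pred (fun _ => False); [apply clopen_empty|].
    intros x; split; [now intros [i [[] _]]|easy].
  - rewrite_pred (fun x => C i x \/ exists i, In i l /\ C i x).
    + now apply clopen_or.
    + intros x; split.
      * intros [j [[<-|Hj] Hx]]; eauto.
      * intros [Hx|[j [Hj Hx]]]; [exists i|exists j]; simpl; auto.
Qed.

Lemma open_list_and {X : Top} (I : Type) (U : I -> X -> Prop) (l : list I) :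
  (forall i, isopen (U i)) -> isopen (fun x => forall i, In i l -> U i x).
Proof.
  intros HU. induction l as [|i l IH].
  - apply open_ext with (fun _ => True); [easy|apply open_full].
  - apply open_ext with (fun x => U i x /\ forall j, In j l -> U j x).
    + intros x; split.
      * intros [H1 H2] j [<-|Hj]; auto.
      * intros H; split; [apply H; now left|intros j Hj; apply H; now right].
    + now apply open_inter.
Qed.

Section SmallOpenSets.
Context (K : Type) (K_inf : card_le nat K) (K_pow : kappa_eq_kappa_lt_kappa K) (X : Top).

Lemma small_open (U : X -> Prop) : type_lt K U -> isopen U.
Proof.
  intros [I [c [_ [Hc HU]]]]. apply open_ext with (fun x => exists i, c i x).
  - intros x. symmetry. apply HU.
  - apply open_Union. intros i. apply Hc.
Qed.

Lemma small_clopen (C : X -> Prop) : isclopen C -> type_lt K C.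
Proof.
  intros HC. exists unit, (fun _ => C). split; [now apply unit_lt|split; [easy|]].
  intros x; split; [now exists tt|now intros []].
Qed.

(** Regularity of kappa: the clopen pieces of all members are indexed by a sigma type, to which
    [sigma_lt] applies. *)
Lemma small_Union (I : Type) (U : I -> X -> Prop) :
  card_lt I K -> (forall i, type_lt K (U i)) -> type_lt K (fun x => exists i, U i x).
Proof.
  intros HI HU.
  pose (J := fun i => constructive_indefinite_description _ (HU i)).
  pose (c := fun i => constructive_indefinite_description _ (proj2_sig (J i))).
  exists {i & proj1_sig (J i)}, (fun p => proj1_sig (c (projT1 p)) (projT2 p)).
  split; [|split].
  - apply sigma_lt; auto. intros i. apply (proj2_sig (c i)).
  - intros [i j]. apply (proj2_sig (c i)).
  - intros x; split.
    + intros [i Hx]. apply (proj2_sig (c i)) in Hx. destruct Hx as [j Hx]. now exists (existT _ i j).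
    + intros [[i j] Hx]. exists i. apply (proj2_sig (c i)). now exists j.
Qed.

Lemma small_or (U V : X -> Prop) : type_lt K U -> type_lt K V -> type_lt K (fun x => U x \/ V x).
Proof.
  intros HU HV. rewrite_pred (fun x => exists b : bool, (if b then U else V) x).
  - apply small_Union; [now apply bool_lt|now intros []].
  - intros x; split.
    + intros [H|H]; [now exists true|now exists false].
    + intros [[] H]; auto.
Qed.

Lemma small_bUnion (I : Type) (P : I -> Prop) (U : I -> X -> Prop) :
  card_lt {i | P i} K -> (forall i, P i -> type_lt K (U i)) ->
  type_lt K (fun x => exists i, P i /\ U i x).
Proof.
  intros HP HU.
  rewrite_pred (fun x => exists i : {i | P i}, U (proj1_sig i) x).
  - apply small_Union; [exact HP|]. intros [i Hi]. now apply HU.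
  - intros x; split.
    + intros [i [Hi Hx]]. now exists (exist _ i Hi).
    + intros [[i Hi] Hx]. now exists i.
Qed.

Lemma small_and_const (P : Prop) (U : X -> Prop) : type_lt K U -> type_lt K (fun x => P /\ U x).
Proof.
  intros HU. destruct (classic P) as [HP|HP].
  - rewrite_pred U; [exact HU|tauto].
  - rewrite_pred (fun _ => False); [|tauto]. apply small_clopen, clopen_empty.
Qed.

End SmallOpenSets.

(** * Clopen sets from compactness and from the F and G conditions *)

Lemma zero_dimensional_clopen {X : Top} (U : X -> Prop) (x : X) :
  zero_dimensional X -> isopen U -> U x ->
  exists C, isclopen C /\ C x /\ forall y, C y -> U y.
Proof.
  intros [I [b [[_ Hb] Hc]]] HU Ux. destruct (Hb U x HU Ux) as [i [Hx Hi]].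
  exists (b i). auto.
Qed.

(** By compactness, finitely many clopen sets, each inside [U] or disjoint from [A], cover the
    space; the union of those inside [U] serves. *)
Lemma clopen_between {X : Top} (A U : X -> Prop) :
  Defs.compact X -> zero_dimensional X -> isclosed A -> isopen U -> (forall x, A x -> U x) ->
  exists C, isclopen C /\ (forall x, A x -> C x) /\ (forall x, C x -> U x).
Proof.
  intros cX zX HA HU AU.
  pose (good := fun C : X -> Prop => isclopen C /\
    ((forall y, C y -> U y) \/ (forall y, C y -> ~ A y))).
  destruct (cX {C | good C} (fun i => proj1_sig i)) as [l Hl].
  - intros [C HC]. apply (proj1 HC).
  - intros x. destruct (classic (A x)) as [Ax|Ax].
    + destruct (zero_dimensional_clopen U x zX HU (AU x Ax)) as [C [HC [Cx CU]]].
      assert (G : good C) by (split; auto). now exists (exist _ C G).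
    + destruct (zero_dimensional_clopen _ x zX HA Ax) as [C [HC [Cx CA]]].
      assert (G : good C) by (split; auto). now exists (exist _ C G).
  (* [D] empties the members not inside [U], so the list need not be filtered. *)
  - pose (D := fun (i : {C | good C}) y => (forall y, proj1_sig i y -> U y) /\ proj1_sig i y).
    exists (fun x => exists i, In i l /\ D i x). split; [|split].
    + apply clopen_list_or. intros [C [HC HG]]. unfold D; simpl.
      destruct (classic (forall y, C y -> U y)).
      * rewrite_pred C; [exact HC|tauto].
      * rewrite_pred (fun _ => False); [apply clopen_empty|tauto].
    + intros x Ax. destruct (Hl x) as [i [Hi Hx]]. exists i. split; [exact Hi|].
      split; [|exact Hx]. destruct (proj2_sig i) as [_ [H|H]]; [exact H|].
      now destruct (H x Hx).
    + intros x [i [_ [H Hx]]]. auto.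
Qed.

Lemma Ropen_gt (a : R) : Ropen (fun r => r > a).
Proof.
  intros r Hr. exists (r - a). split; [lra|]. intros y Hy.
  apply Rabs_def2 in Hy. lra.
Qed.

Lemma Ropen_lt (a : R) : Ropen (fun r => r < a).
Proof.
  intros r Hr. exists (a - r). split; [lra|]. intros y Hy.
  apply Rabs_def2 in Hy. lra.
Qed.

Lemma rcont_preimage {X : Top} (g : X -> R) (V : R -> Prop) :
  rcont_on (fun _ => True) g -> Ropen V -> isopen (fun x => V (g x)).
Proof.
  intros Hg HV. destruct (Hg V HV) as [W [HW H]]. apply open_ext with W; auto.
Qed.

Definition indicator {A : Type} (P : A -> Prop) (a : A) : R :=
  if excluded_middle_informative (P a) then 1 else 0.

Lemma indicator_in {A : Type} (P : A -> Prop) a : P a -> indicator P a = 1.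
Proof. unfold indicator. destruct excluded_middle_informative; tauto. Qed.

Lemma indicator_out {A : Type} (P : A -> Prop) a : ~ P a -> indicator P a = 0.
Proof. unfold indicator. destruct excluded_middle_informative; tauto. Qed.

Lemma indicator_bounded {A : Type} (P D : A -> Prop) : bounded_on D (indicator P).
Proof.
  exists 1. intros a _. unfold indicator.
  destruct excluded_middle_informative; rewrite ?Rabs_R1, ?Rabs_R0; lra.
Qed.

(** Only the values 0 and 1 occur, so the preimage of [O] is assembled from [U] if [O 1] holds and
    from [V] if [O 0] holds. *)
Lemma indicator_rcont {X : Top} (D P U V : X -> Prop) :
  isopen U -> isopen V -> (forall x, D x -> (P x <-> U x)) -> (forall x, D x -> (~ P x <-> V x)) ->
  rcont_on D (indicator P).
Proof.
  intros HU HV PU PV O _.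
  exists (fun x => (O 1 /\ U x) \/ (O 0 /\ V x)). split.
  - apply open_or; now apply open_and_const.
  - intros x Dx. specialize (PU x Dx); specialize (PV x Dx). unfold indicator.
    destruct excluded_middle_informative; tauto.
Qed.

Section Separation.
Context (K : Type) (K_inf : card_le nat K) (K_pow : kappa_eq_kappa_lt_kappa K).
Context (X : Top) (HX : kappa_Parovicenko K X).

(** The F condition extends the indicator of [P] from the union of [P] and [N] to a continuous [g].
    A clopen set between the closed set where [g] is at least 2/3 and the open set where [g] exceeds
    1/3 separates. *)
Lemma separation (P N : X -> Prop) :
  type_lt K P -> type_lt K N -> (forall x, P x -> ~ N x) ->
  exists C, isclopen C /\ (forall x, P x -> C x) /\ (forall x, N x -> ~ C x).
Proof.
  destruct HX as [cX [_ [zX [FX _]]]]. intros HP HN PN.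
  destruct (FX (fun x => P x \/ N x)) with (f := indicator P) as [g [Hg gE]].
  - apply open_or; eapply small_open; eauto.
  - now apply small_or.
  - apply indicator_bounded.
  - apply indicator_rcont with P N; try (eapply small_open; eauto); firstorder.
  - destruct (clopen_between (fun x => ~ g x < 2/3) (fun x => g x > 1/3) cX zX) as [C [HC [AC CU]]].
    + unfold isclosed. apply open_ext with (fun x => g x < 2/3).
      * intros x; split; [tauto|apply NNPP].
      * apply (rcont_preimage g (fun r => r < 2/3)); [exact Hg|apply Ropen_lt].
    + apply (rcont_preimage g (fun r => r > 1/3)); [exact Hg|apply Ropen_gt].
    + intros x Hx. lra.
    + exists C. split; [exact HC|split].
      * intros x Px. apply AC. rewrite gE by auto. rewrite indicator_in by auto. lra.
      * intros x Nx Cx. apply CU in Cx. rewrite gE in Cx by auto.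
        rewrite indicator_out in Cx by firstorder. lra.
Qed.

Lemma open_neq (p : X) : isopen (fun y => y <> p).
Proof.
  apply open_local. intros y Hy.
  destruct (proj1 (proj2 HX) y p Hy) as [U [V [HU [HV [Uy [Vp UV]]]]]].
  exists U. split; [exact HU|split; [exact Uy|]]. intros z Uz ->. eauto.
Qed.

(** The part of [V] outside [U] is an intersection of fewer than kappa open sets and contains [p],
    so the G condition gives a non-empty open [W] inside it. As [p] is not isolated, [W] has a point
    other than [p], around which [E] is chosen. *)
Lemma clopen_avoiding (U V : X -> Prop) (p : X) :
  type_lt K U -> ~ U p -> isclopen V -> V p ->
  exists E, isclopen E /\ (exists y, E y) /\ ~ E p /\ forall y, E y -> V y /\ ~ U y.
Proof.
  intros [I [c [HI [Hc HU]]]] Up HV Vp.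
  pose proof HX as [_ [_ [zX [_ [GX iX]]]]].
  destruct (GX (unit + I)%type
              (fun s y => match s with inl _ => V y | inr i => ~ c i y end)) as [W [HW [[y Wy] WV]]].
  - apply sum_lt; auto. now apply unit_lt.
  - intros [[]|i]; [apply HV|apply Hc].
  - exists p. intros [[]|i]; [exact Vp|]. intros Hp. apply Up, HU. eauto.
  - assert (exists z, W z /\ z <> p) as [z [Wz zp]].
    { apply NNPP; intros Nz. apply (iX p). apply open_ext with W; [|exact HW].
      assert (H : forall z, W z -> z = p) by (intros z Wz; apply NNPP; eauto).
      intros z; split; [apply H|]. intros ->. now rewrite <- (H y Wy). }
    destruct (zero_dimensional_clopen (fun t => W t /\ t <> p) z zX) as [E [HE [Ez EW]]].
    + apply open_inter; [exact HW|apply open_neq].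
    + easy.
    + exists E. split; [exact HE|]. split; [eauto|]. split; [intros Ep; now apply (EW p Ep)|].
      intros t Et. apply EW in Et. destruct Et as [Wt _]. split.
      * exact (WV t Wt (inl tt)).
      * intros Ut. apply HU in Ut. destruct Ut as [i Ut]. exact (WV t Wt (inr i) Ut).
Qed.

(** If some small [U] missing [x] accumulates at [x], a clopen set separating [A] from [U] cannot
    contain [x]. If there is no such [U], then [A] itself does not accumulate at [x], and the empty
    shield works. *)
Lemma shield_exists (x : X) :
  exists U0, type_lt K U0 /\ ~ U0 x /\
    forall A, type_lt K A -> ~ A x -> (forall y, A y -> ~ U0 y) ->
      exists Z, isclopen Z /\ ~ Z x /\ forall y, A y -> Z y.
Proof.
  destruct (classic (exists U, type_lt K U /\ ~ U x /\
              forall Z, isclopen Z -> Z x -> exists y, Z y /\ U y)) as [[U [HU [Ux cl]]]|N].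
  - exists U. split; [exact HU|split; [exact Ux|]]. intros A HA _ AU.
    destruct (separation A U HA HU AU) as [Z [HZ [AZ UZ]]].
    exists Z. split; [exact HZ|split; [|exact AZ]].
    intros Zx. destruct (cl Z HZ Zx) as [y [Zy Uy]]. exact (UZ y Uy Zy).
  - exists (fun _ => False). split; [apply small_clopen; auto; apply clopen_empty|].
    split; [easy|]. intros A HA Ax _. apply NNPP; intros N'. apply N.
    exists A. split; [exact HA|split; [exact Ax|]]. intros Z HZ Zx.
    apply NNPP; intros N''. apply N'. exists (fun y => ~ Z y).
    split; [now apply clopen_not|]. split; [tauto|]. intros y Ay Zy. eauto.
Qed.

End Separation.

(** * The almost disjoint family *)

(** [Q a G b] mentions a total function [G], but by locality only its values before [a] count. The
    step may assume that all earlier values already satisfy their conditions. *)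
Lemma wf_recursive_choice (A B : Type) (R : A -> A -> Prop) (Q : A -> (A -> B) -> B -> Prop) :
  inhabited B -> well_founded R ->
  (forall a G G' b, (forall a', R a' a -> G a' = G' a') -> Q a G b -> Q a G' b) ->
  (forall a G, (forall a', R a' a -> Q a' G (G a')) -> exists b, Q a G b) ->
  exists G, forall a, Q a G (G a).
Proof.
  intros iB wf local step.
  (* Off the predecessors of [a] a default value is used; locality makes it harmless. *)
  pose (below := fun a (rec : forall a', R a' a -> B) a' =>
    match excluded_middle_informative (R a' a) with
    | left h => rec a' h
    | right _ => epsilon iB (fun _ => True)
    end).
  pose (body := fun a (rec : forall a', R a' a -> B) => epsilon iB (Q a (below a rec))).
  pose (G := Fix wf (fun _ => B) body).
  assert (GE : forall a, G a = epsilon iB (Q a (below a (fun a' _ => G a')))).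
  { intros a. unfold G at 1. rewrite Fix_eq; [reflexivity|].
    intros a' f g fg. replace g with f; [reflexivity|].
    extensionality a''; extensionality h; apply fg. }
  exists G. intros a. induction (wf a) as [a _ IH].
  assert (agree : forall a', R a' a -> G a' = below a (fun a' _ => G a') a').
  { intros a' Ha'. unfold below. now destruct excluded_middle_informative. }
  destruct (step a G IH) as [b Hb].
  apply local with (below a (fun a' _ => G a')); [intros; symmetry; auto|].
  rewrite GE. apply epsilon_spec. exists b. eapply local; eauto.
Qed.

Section AlmostDisjoint.
Context (K : Type) (K_inf : card_le nat K) (K_pow : kappa_eq_kappa_lt_kappa K).
Context (X : Top) (HX : kappa_Parovicenko K X).
Context (lt : K -> K -> Prop) (lt_wf : well_founded lt)
  (lt_trans : forall a b c, lt a b -> lt b c -> lt a c)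
  (lt_total : forall a b, lt a b \/ a = b \/ lt b a)
  (lt_small : forall a, card_lt {b | lt b a} K).

Lemma le_small a : card_lt {b | lt b a \/ b = a} K.
Proof.
  apply card_lt_of_le with ({b | lt b a} + unit)%type.
  - exists (fun p : {b | lt b a \/ b = a} =>
      match excluded_middle_informative (lt (proj1_sig p) a) with
      | left h => inl (exist (fun b => lt b a) (proj1_sig p) h)
      | right _ => inr tt
      end).
    intros [b Hb] [c Hc]; simpl.
    destruct (excluded_middle_informative (lt b a)), (excluded_middle_informative (lt c a));
      intros E; try easy.
    + injection E as E. subst c. f_equal. apply proof_irrelevance.
    + assert (b = c) by (destruct Hb, Hc; congruence || tauto). subst c.
      f_equal. apply proof_irrelevance.
  - apply sum_lt; auto. now apply unit_lt.
Qed.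

(** Otherwise [K] would be covered by finitely many closed initial segments, each smaller than
    kappa, against regularity. *)
Lemma list_bounded (l : list K) : exists a, forall b, In b l -> lt b a.
Proof.
  apply NNPP; intros N.
  assert (H : forall a, exists b, In b l /\ (lt a b \/ a = b)).
  { intros a. apply NNPP; intros Na. apply N. exists a. intros b Hb.
    destruct (lt_total b a) as [H|[H|H]]; [exact H| |]; destruct Na; exists b; auto. }
  destruct (choice _ H) as [g Hg].
  assert (L : card_lt {b | In b l} K).
  { apply card_lt_of_le with {m | m < length l}%nat; [|now apply finite_lt].
    destruct (choice (fun (b : {b | In b l}) n => (n < length l)%nat /\ nth_error l n = Some (proj1_sig b)))
      as [ix Hix].
    { intros [b Hb]. destruct (In_nth_error l b Hb) as [n Hn]. exists n. split; [|exact Hn].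
      apply nth_error_Some. now rewrite Hn. }
    exists (fun b => exist (fun m => m < length l)%nat (ix b) (proj1 (Hix b))).
    intros b c E. apply (f_equal (@proj1_sig _ _)) in E. simpl in E.
    pose proof (proj2 (Hix b)) as Eb. pose proof (proj2 (Hix c)) as Ec.
    rewrite E, Ec in Eb. injection Eb as Eb. destruct b, c; simpl in Eb. subst.
    f_equal. apply proof_irrelevance. }
  pose proof (sigma_lt K K_inf K_pow {b | In b l} (fun b => {a | lt a (proj1_sig b) \/ a = proj1_sig b})
     L (fun b => le_small (proj1_sig b))) as [_ NS].
  apply NS.
  exists (fun a => existT (fun b : {b | In b l} => {a | lt a (proj1_sig b) \/ a = proj1_sig b})
    (exist (fun b => In b l) (g a) (proj1 (Hg a))) (exist _ a (proj2 (Hg a)))).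
  intros a b E.
  exact (f_equal (fun q : {b : {b | In b l} & {a | lt a (proj1_sig b) \/ a = proj1_sig b}} =>
                    proj1_sig (projT2 q)) E).
Qed.

(** Serves twice: near [x] to produce the sets [E a], and near a point of each [E a] to produce the
    pieces inside it. Every member avoids [p], so the earlier members form a small open set missing
    [p], and [clopen_avoiding] yields the next one. *)
Lemma fresh_sequence (p : X) (V U0 : X -> Prop) (C : K -> X -> Prop) :
  isclopen V -> V p -> type_lt K U0 -> ~ U0 p ->
  (forall k, isclopen (C k)) -> (forall k, ~ C k p) ->
  exists E : K -> X -> Prop, forall k,
    isclopen (E k) /\ (exists y, E k y) /\ ~ E k p /\
    forall y, E k y -> V y /\ ~ U0 y /\ forall j, lt j k -> ~ C j y /\ ~ E j y.
Proof.
  intros HV Vp HU0 U0p HC Cp.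
  apply (wf_recursive_choice K (X -> Prop) lt (fun k E b =>
    isclopen b /\ (exists y, b y) /\ ~ b p /\
    forall y, b y -> V y /\ ~ U0 y /\ forall j, lt j k -> ~ C j y /\ ~ E j y)).
  - exact (inhabits (fun _ => True)).
  - exact lt_wf.
  - intros k E E' b EE' [H1 [H2 [H3 H4]]]. repeat (split; [assumption|]).
    intros y Hy. destruct (H4 y Hy) as [Vy [Uy Hj]]. split; [exact Vy|split; [exact Uy|]].
    intros j jk. rewrite <- EE' by exact jk. auto.
  - intros k E HE.
    destruct (clopen_avoiding K K_inf K_pow X HX
      (fun y => U0 y \/ exists j, lt j k /\ (C j y \/ E j y)) V p) as [D [HD [Dn [Dp DV]]]]; auto.
    + apply small_or; auto. apply small_bUnion; auto.
      intros j jk. apply small_or; auto; apply small_clopen; auto. now apply HE.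
    + intros [H|[j [jk [H|H]]]]; [now apply U0p|now apply (Cp j)|].
      destruct (HE j jk) as [_ [_ [H' _]]]. now apply H'.
    + exists D. repeat (split; [assumption|]). intros y Dy. destruct (DV y Dy) as [Vy Ny].
      split; [exact Vy|split; [tauto|]]. intros j jk. split; intros H; apply Ny; right; exists j; auto.
Qed.

Definition agree (a : K) (f g : K -> Prop) : Prop := forall b, lt b a -> (f b <-> g b).

(** A restriction below [a] is a two-valued function on fewer than kappa points, so the cardinal
    hypothesis codes it by an element of [K]. The recursion can then run over pairs of a level and a
    code. *)
Lemma code_exists : exists code : K -> (K -> Prop) -> K,
  forall a f g, code a f = code a g <-> agree a f g.
Proof.
  destruct K_inf as [n Hn].
  assert (Hc : forall a, exists c : (K -> Prop) -> K, forall f g, c f = c g <-> agree a f g).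
  { intros a. destruct (K_pow _ (lt_small a)) as [h Hh].
    exists (fun f => h (fun b => n (if excluded_middle_informative (f (proj1_sig b)) then 0 else 1)%nat)).
    intros f g; split.
    - intros E b ba. apply Hh in E. apply equal_f with (exist (fun b => lt b a) b ba) in E.
      apply Hn in E. simpl in E.
      destruct (excluded_middle_informative (f b)), (excluded_middle_informative (g b)); easy.
    - intros fg. f_equal. extensionality b. destruct b as [b ba]; simpl. specialize (fg b ba).
      destruct (excluded_middle_informative (f b)), (excluded_middle_informative (g b)); tauto. }
  destruct (choice _ Hc) as [code H]. now exists code.
Qed.

(** * The transfinite recursion over levels and codes *)

Context (x : X) (U0 : X -> Prop) (U0_small : type_lt K U0).
Context (hull : (X -> Prop) -> X -> Prop)
  (hull_spec : forall A, type_lt K A -> ~ A x -> (forall y, A y -> ~ U0 y) ->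
     isclopen (hull A) /\ ~ hull A x /\ forall y, A y -> hull A y).
Context (C : K -> X -> Prop) (C_clopen : forall a, isclopen (C a)) (C_x : forall a, ~ C a x).
Context (E : K -> X -> Prop) (E_clopen : forall a, isclopen (E a))
  (E_C : forall a y, E a y -> C a y) (E_U0 : forall a y, E a y -> ~ U0 y)
  (E_new : forall a b y, lt b a -> E a y -> ~ C b y).
Context (E' : K -> K -> X -> Prop) (E'_clopen : forall a c, isclopen (E' a c))
  (E'_E : forall a c y, E' a c y -> E a y)
  (E'_disjoint : forall a c d y, c <> d -> E' a c y -> ~ E' a d y).
Context (code : K -> (K -> Prop) -> K)
  (code_eq : forall a f g, code a f = code a g <-> agree a f g).
Context (rep : K -> K -> K -> Prop) (rep_code : forall a f, code a (rep a (code a f)) = code a f).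

(** The part of [W_f] built at the levels up to and including [a]. It depends on [f] strictly below
    [a] only, since [code a] sees no more. *)
Definition trace (G : K * K -> X -> Prop) (a : K) (f : K -> Prop) (y : X) : Prop :=
  exists b, (lt b a \/ b = a) /\ G (b, code b f) y.

(* The value at (a, c) is the intersection with C a of every W_f such that c codes f below a. *)
Definition stage (p : K * K) (G : K * K -> X -> Prop) (D : X -> Prop) : Prop :=
  let (a, c) := p in
  isclopen D /\
  (forall y, D y -> C a y /\ ~ U0 y) /\
  (forall b y, lt b a -> C a y -> C b y -> (D y <-> G (b, code b (rep a c)) y)) /\
  (forall y, E a y -> (D y <-> E' a c y)) /\
  (forall d b y, lt d c -> lt b a ->
     agree b (rep a c) (rep a d) -> ~ (rep a c b <-> rep a d b) ->
     D y -> G (a, d) y -> hull (trace G b (rep a c)) y).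

Lemma agree_le a b f g : agree a f g -> lt b a \/ b = a -> agree b f g.
Proof. intros H [ba| ->] c cb; apply H; eauto. Qed.

Lemma agree_sym a f g : agree a f g -> agree a g f.
Proof. intros H b ba. symmetry. auto. Qed.

Lemma agree_trans a f g h : agree a f g -> agree a g h -> agree a f h.
Proof. intros H1 H2 b ba. rewrite (H1 b ba). auto. Qed.

Lemma rep_agree a f : agree a (rep a (code a f)) f.
Proof. now apply code_eq. Qed.

Lemma code_rep a b f : lt b a -> code b (rep a (code a f)) = code b f.
Proof. intros ba. apply code_eq. apply agree_le with a; [apply rep_agree|now left]. Qed.

Lemma trace_agree G a f g : agree a f g -> trace G a f = trace G a g.
Proof.
  intros fg. apply pred_ext. intros y. unfold trace.
  enough (H : forall b, lt b a \/ b = a -> code b f = code b g).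
  { split; intros [b [ba Hy]]; exists b; split; auto; [rewrite <- H|rewrite H]; auto. }
  intros b ba. apply code_eq. eapply agree_le; eauto.
Qed.

(** The compatibility clause at the larger of the two levels transports membership in either
    direction. *)
Lemma coherent G f a b y :
  stage (a, code a f) G (G (a, code a f)) -> stage (b, code b f) G (G (b, code b f)) ->
  C a y -> C b y -> G (a, code a f) y -> G (b, code b f) y.
Proof.
  intros [_ [_ [Ha _]]] [_ [_ [Hb _]]] Cay Cby Gy.
  destruct (lt_total a b) as [ab|[<-|ba]]; [|exact Gy|].
  - apply (Hb a y); auto. now rewrite code_rep.
  - apply (Ha b y) in Gy; auto. now rewrite code_rep in Gy.
Qed.

(** A stage controls only smaller codes, so the stage with the larger code is used; equal codes
    would force [f b <-> g b]. The hull is the same for [f], [g] and their representatives, as all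
    agree below [b]. *)
Lemma level_disjoint G a b f g y :
  stage (a, code a f) G (G (a, code a f)) -> stage (a, code a g) G (G (a, code a g)) ->
  lt b a -> agree b f g -> ~ (f b <-> g b) ->
  G (a, code a f) y -> G (a, code a g) y -> hull (trace G b f) y.
Proof.
  intros [_ [_ [_ [_ Hf]]]] [_ [_ [_ [_ Hg]]]] ba fg Nb fy gy.
  assert (Af : agree b (rep a (code a f)) f) by (eapply agree_le; [apply rep_agree|auto]).
  assert (Ag : agree b (rep a (code a g)) g) by (eapply agree_le; [apply rep_agree|auto]).
  pose proof (rep_agree a f b ba) as Bf. pose proof (rep_agree a g b ba) as Bg.
  destruct (lt_total (code a f) (code a g)) as [H|[H|H]].
  - rewrite (trace_agree G b f (rep a (code a g))).
    + apply Hg with (code a f); auto; [|tauto].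
      eapply agree_trans; [exact Ag|]. eapply agree_trans; [apply agree_sym, fg|]. now apply agree_sym.
    + eapply agree_trans; [exact fg|now apply agree_sym].
  - apply code_eq in H. destruct Nb. now apply H.
  - rewrite (trace_agree G b f (rep a (code a f))) by now apply agree_sym.
    apply Hf with (code a g); auto; [|tauto].
    eapply agree_trans; [exact Af|]. eapply agree_trans; [exact fg|]. now apply agree_sym.
Qed.

(** The shield enters here: a trace is a union of fewer than kappa clopen sets that miss [U0], and
    they miss [x] because each lies in its [C b]. *)
Lemma hull_trace G a f :
  (forall b, lt b a \/ b = a -> stage (b, code b f) G (G (b, code b f))) ->
  isclopen (hull (trace G a f)) /\ ~ hull (trace G a f) x /\
  forall y, trace G a f y -> hull (trace G a f) y.
Proof.
  intros HG. apply hull_spec.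
  - apply small_bUnion; auto; [apply le_small|].
    intros b Hb. apply small_clopen; auto. now apply HG.
  - intros [b [Hb Hx]]. destruct (HG b Hb) as [_ [H _]]. apply H in Hx. now apply (C_x b).
  - intros y [b [Hb Hy]]. destruct (HG b Hb) as [_ [H _]]. now apply H in Hy.
Qed.

(** Only lexicographically earlier pairs are consulted: lower levels, or the same level with a
    smaller code. *)
Lemma stage_local p G G' D :
  (forall q, slexprod K K lt lt q p -> G q = G' q) -> stage p G D -> stage p G' D.
Proof.
  destruct p as [a c]. intros GG' [H1 [H2 [H3 [H4 H5]]]].
  split; [exact H1|]. split; [exact H2|]. split; [|split; [exact H4|]].
  - intros b y ba. rewrite <- GG'; [auto|now constructor].
  - intros d b y dc ba A N Dy. rewrite <- GG'; [|now constructor].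
    replace (trace G' b (rep a c)) with (trace G b (rep a c)); [now apply (H5 d)|].
    apply pred_ext. intros z.
    enough (H : forall b', lt b' b \/ b' = b -> forall k, G (b', k) = G' (b', k)).
    { unfold trace. split; intros [b' [Hb' Hz]]; exists b'; split; auto; [rewrite <- H|rewrite H]; auto. }
    intros b' Hb' k. apply GG'. constructor. destruct Hb'; subst; eauto.
Qed.

(** Forced into [D] are the points inherited from lower levels and the reserved piece. Forced out
    are the points rejected at lower levels, [U0], the rest of [E a], and the points of conflicting
    earlier sets of this level outside the hull. Both collections are small, so the work lies in
    their disjointness. *)
Lemma stage_step p G :
  (forall q, slexprod K K lt lt q p -> stage q G (G q)) -> exists D, stage p G D.
Proof.
  destruct p as [a c]. intros HG. set (s := rep a c).
  assert (Hlow : forall b k, lt b a -> stage (b, k) G (G (b, k))) by (intros; apply HG; now constructor).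
  assert (Hside : forall d, lt d c -> stage (a, d) G (G (a, d))) by (intros; apply HG; now constructor).
  (* Here [b] is the first place where the functions of [c] and [d] differ. *)
  pose (conflict := fun d b => agree b s (rep a d) /\ ~ (s b <-> rep a d b)).
  assert (Hh : forall b, lt b a -> isclopen (hull (trace G b s)) /\ ~ hull (trace G b s) x /\
                 forall y, trace G b s y -> hull (trace G b s) y).
  { intros b ba. apply hull_trace. intros b' Hb'. apply Hlow. destruct Hb'; subst; eauto. }
  destruct (separation K K_inf K_pow X HX
    (fun y => (exists b, lt b a /\ (G (b, code b s) y /\ C a y)) \/ E' a c y)
    (fun y => ((exists b, lt b a /\ (C b y /\ ~ G (b, code b s) y)) \/ U0 y) \/
       ((E a y /\ ~ E' a c y) \/
        exists d, lt d c /\ exists b, lt b a /\ (conflict d b /\ (G (a, d) y /\ ~ hull (trace G b s) y)))))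
    as [D [HD [PD ND]]].
  - apply small_or; auto; [|now apply small_clopen].
    apply small_bUnion; auto. intros b ba. apply small_clopen; auto.
    apply clopen_and; auto. apply (Hlow b (code b s) ba).
  - apply small_or; auto; apply small_or; auto.
    + apply small_bUnion; auto. intros b ba. apply small_clopen; auto.
      apply clopen_and; auto. apply clopen_not. apply (Hlow b (code b s) ba).
    + apply small_clopen; auto. apply clopen_and; auto. now apply clopen_not.
    + apply small_bUnion; auto. intros d dc. apply small_bUnion; auto. intros b ba.
      apply small_and_const; auto. apply small_clopen; auto.
      apply clopen_and; [apply (Hside d dc)|]. apply clopen_not. now apply Hh.
  - intros y [[b [ba [Gy Cy]]]|Ey].
    + destruct (Hlow b (code b s) ba) as [_ [CU _]]. destruct (CU y Gy) as [Cby U0y].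
      intros [[[b' [b'a [Cb'y NGy]]]|H]|[[H _]|[d [dc [b' [b'a [[Ag Nb'] [Gdy Nh]]]]]]]].
      * apply NGy. apply coherent with b; auto.
      * auto.
      * now apply (E_new a b y).
      (* As [y] lies in [C b], compatibility brings the conflicting set down from level [a] to level
         [b]. *)
      * assert (Gy' : G (b, code b (rep a d)) y).
        { destruct (Hside d dc) as [_ [_ [Hc _]]]. now apply Hc. }
        (* If [b] is at most the place [b'] of the conflict, [y] lies in the trace itself. Otherwise
           the conflict is already visible at level [b], and [level_disjoint] applies there. *)
        apply Nh. assert (b'b : (lt b b' \/ b = b') \/ lt b' b) by (destruct (lt_total b b'); tauto).
        destruct b'b as [bb'|b'b].
        -- apply Hh; auto. exists b. auto.
        -- apply level_disjoint with b (rep a d); auto.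
    (* [E a] avoids [U0] and every earlier [C b], and within [E a] the earlier sets of this level
       reduce to their own reserved pieces. *)
    + pose proof (E'_E a c y Ey) as Eay.
      intros [[[b' [b'a [Cb'y NGy]]]|H]|[[_ H]|[d [dc [b' [b'a [_ [Gdy Nh]]]]]]]].
      * now apply (E_new a b' y).
      * now apply (E_U0 a y).
      * auto.
      * destruct (Hside d dc) as [_ [_ [_ [He _]]]]. apply He in Gdy; auto.
        apply (E'_disjoint a c d y); auto. intros ->.
        revert dc. clear - lt_wf. induction (lt_wf d) as [d _ IH]. intros dd. eauto.
  (* The separating set may leave [C a], so it is cut down. *)
  - exists (fun y => D y /\ C a y).
    split; [now apply clopen_and|]. split; [|split; [|split]].
    + intros y [Dy Cy]. split; [exact Cy|]. intros Uy. apply (ND y); auto.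
    + intros b y ba Cay Cby. fold s. split.
      * intros [Dy _]. apply NNPP; intros N. apply (ND y); auto. left; left. exists b. auto.
      * intros Gy. split; [|exact Cay]. apply PD. left. exists b. auto.
    + intros y Ey. split.
      * intros [Dy _]. apply NNPP; intros N. apply (ND y); auto.
      * intros Ey'. split; auto.
    + intros d b y dc ba Ag N [Dy _] Gy. fold s. apply NNPP; intros Nh. apply (ND y); auto.
      right; right. exists d. split; [exact dc|]. exists b. unfold conflict. auto.
Qed.

Context (C_cover : forall y, y <> x -> exists a, C a y)
  (E'_nonempty : forall a c, exists y, E' a c y).

Lemma almost_disjoint_of_data :
  exists W : (K -> Prop) -> X -> Prop,
    (forall f, isopen (W f) /\ isopen (fun y => y <> x /\ ~ W f y)) /\
    (forall f Z, isclopen Z -> ~ Z x -> exists y, W f y /\ y <> x /\ ~ Z y) /\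
    (forall f g, f <> g -> exists Z, isclopen Z /\ ~ Z x /\ forall y, W f y -> W g y -> Z y).
Proof.
  destruct (wf_recursive_choice (K * K) (X -> Prop) (slexprod K K lt lt) stage) as [G HG].
  - exact (inhabits (fun _ => True)).
  - now apply wf_slexprod.
  - exact stage_local.
  - exact stage_step.
  - pose (W := fun f y => exists a, G (a, code a f) y).
    (* Coherence makes [W f] agree on [C a] with its set at level [a]; hence its complement off [x]
       is open too. *)
    assert (WC : forall f a y, C a y -> W f y -> G (a, code a f) y).
    { intros f a y Cy [b Gy]. apply coherent with b; auto.
      destruct (HG (b, code b f)) as [_ [H _]]. now apply H. }
    exists W. split; [|split].
    + intros f. split.
      * apply open_Union. intros a. apply (HG (a, code a f)).
      * apply open_ext with (fun y => exists a, C a y /\ ~ G (a, code a f) y).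
        -- intros y; split.
           ++ intros [a [Cy NG]]. split; [intros ->; now apply (C_x a)|]. auto.
           ++ intros [yx NW]. destruct (C_cover y yx) as [a Cy]. exists a. split; [exact Cy|].
              intros Gy. apply NW. now exists a.
        -- apply open_Union. intros a. apply clopen_and; auto. apply clopen_not, (HG (a, code a f)).
    + intros f Z HZ Zx.
      (* Finitely many [C b] and the complement of [Z], tagged [None], cover the space. A piece of
         [E a] with [a] above all these [b] misses each [C b], so it lies outside [Z]. *)
      destruct (proj1 HX (option K) (fun o y => match o with None => ~ Z y | Some a => C a y end))
        as [l Hl].
      * intros [a|]; [apply C_clopen|apply HZ].
      * intros y. destruct (classic (y = x)) as [->|yx]; [now exists None|].
        destruct (C_cover y yx) as [a Cy]. now exists (Some a).
      * destruct (list_bounded (flat_map (fun o => match o with Some a => a :: nil | None => nil end) l))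
          as [a Ha].
        destruct (E'_nonempty a (code a f)) as [y Ey].
        pose proof (E'_E _ _ _ Ey) as Eay.
        exists y. split; [|split].
        -- exists a. destruct (HG (a, code a f)) as [_ [_ [_ [H _]]]]. now apply H.
        -- intros ->. apply (C_x a). auto.
        -- intros Zy. destruct (Hl y) as [[b|] [Hb Hy]]; [|tauto].
           apply (E_new a b y); auto. apply Ha. apply in_flat_map. exists (Some b). simpl. auto.
    + intros f g fg.
      assert (exists b, ~ (f b <-> g b) /\ agree b f g) as [b [Nb Ab]].
      { apply NNPP; intros N. apply fg. apply pred_ext. intros b.
        induction (lt_wf b) as [b _ IH]. apply NNPP; intros Nb. apply N. exists b. split; auto. }
      destruct (hull_trace G b f) as [H1 [H2 H3]]; [auto|].
      exists (hull (trace G b f)). split; [exact H1|split; [exact H2|]].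
      intros y [a Gy] Wg.
      (* Here [b] is the first difference of [f] and [g]. Points entering [W f] at a level up to [b]
         lie in the trace; at later levels [level_disjoint] puts those shared with [W g] in its
         hull. *)
      destruct (lt_total a b) as [ab|[ab|ba]]; [apply H3; exists a; auto..|].
      apply level_disjoint with a g; auto. apply WC; auto.
      destruct (HG (a, code a f)) as [_ [H _]]. now apply H.
Qed.

End AlmostDisjoint.

(** * Choosing the data of the recursion *)

(** The given base need not be clopen: a member that fits in some clopen set missing [x] is enlarged
    to one, and any other is replaced by the empty set. *)
Lemma clopen_cover_of_punctured {K : Type} {X : Top} (x : X) :
  zero_dimensional X -> hausdorff X -> (exists b : K -> X -> Prop, is_base b) ->
  exists C : K -> X -> Prop, (forall k, isclopen (C k)) /\ (forall k, ~ C k x) /\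
    forall y, y <> x -> exists k, C k y.
Proof.
  intros zX hX [b [_ Hb]].
  destruct (choice (fun k D => isclopen D /\ ~ D x /\
    ((exists D', isclopen D' /\ ~ D' x /\ forall y, b k y -> D' y) -> forall y, b k y -> D y)))
    as [C HC].
  - intros k. destruct (classic (exists D', isclopen D' /\ ~ D' x /\ forall y, b k y -> D' y))
      as [[D [H1 [H2 H3]]]|N].
    + exists D. auto.
    + exists (fun _ => False). split; [apply clopen_empty|]. split; tauto.
  - exists C. split; [apply HC|split; [apply HC|]]. intros y yx.
    destruct (hX y x yx) as [U [V [HU [HV [Uy [Vx UV]]]]]].
    destruct (zero_dimensional_clopen U y zX HU Uy) as [D [HD [Dy DU]]].
    destruct (Hb D y (proj1 HD) Dy) as [k [ky kD]].
    exists k. apply HC; [|exact ky]. exists D. split; [exact HD|split; [|exact kD]].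
    intros Dx. eauto.
Qed.

Lemma almost_disjoint_clopen_family (K : Type) (X : Top) (x : X) :
  card_le nat K -> kappa_eq_kappa_lt_kappa K -> kappa_Parovicenko K X ->
  (exists b : K -> X -> Prop, is_base b) ->
  exists W : (K -> Prop) -> X -> Prop,
    (forall f, isopen (W f) /\ isopen (fun y => y <> x /\ ~ W f y)) /\
    (forall f Z, isclopen Z -> ~ Z x -> exists y, W f y /\ y <> x /\ ~ Z y) /\
    (forall f g, f <> g -> exists Z, isclopen Z /\ ~ Z x /\ forall y, W f y -> W g y -> Z y).
Proof.
  intros K_inf K_pow HX base.
  destruct (initial_well_order_exists K) as [lt [wf [tr [tot small]]]].
  destruct (code_exists K K_inf K_pow lt small) as [code Hcode].
  destruct (shield_exists K K_inf K_pow X HX x) as [U0 [U0_small [U0x HU0]]].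
  destruct (choice (fun A Z => type_lt K A -> ~ A x -> (forall y, A y -> ~ U0 y) ->
     isclopen Z /\ ~ Z x /\ forall y, A y -> Z y)) as [hull Hhull].
  { intros A. destruct (classic (type_lt K A /\ ~ A x /\ forall y, A y -> ~ U0 y)) as [[H1 [H2 H3]]|N].
    - destruct (HU0 A H1 H2 H3) as [Z HZ]. now exists Z.
    - exists A. tauto. }
  destruct (clopen_cover_of_punctured x (proj1 (proj2 (proj2 HX))) (proj1 (proj2 HX)) base)
    as [C [HC [Cx Ccover]]].
  destruct (fresh_sequence K K_inf K_pow X HX lt wf small x (fun _ => True) U0 C) as [E HE]; auto.
  { split; [apply open_full|]. apply open_ext with (fun _ => False); [tauto|apply open_empty]. }
  destruct (choice (fun a E'a => forall c : K, isclopen (E'a c) /\ (exists y, E'a c y) /\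
      (forall y, E'a c y -> E a y) /\ forall d y, c <> d -> E'a c y -> ~ E'a d y)) as [E' HE'].
  (* The same construction at a point [p] of [E a], with nothing further to avoid, gives kappa many
     disjoint pieces. *)
  { intros a. destruct (HE a) as [Ea [[p Ep] _]].
    destruct (fresh_sequence K K_inf K_pow X HX lt wf small p (E a) (fun _ => False)
      (fun _ _ => False)) as [F HF]; auto using clopen_empty.
    { apply small_clopen; auto using clopen_empty. }
    exists F. intros c. destruct (HF c) as [H1 [H2 [_ H3]]].
    split; [exact H1|split; [exact H2|split]].
    - intros y Hy. now apply H3.
    - intros d y cd Fc Fd. destruct (tot c d) as [H|[H|H]]; [|auto|].
      + destruct (HF d) as [_ [_ [_ H4]]]. apply (H4 y Fd) in H; tauto.
      + destruct (H3 y Fc) as [_ [_ H4]]. apply H4 in H. tauto. }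
  (* Adding [E a] to [C a] puts [E a] inside its cover set; freshness against the earlier [C] and
     [E] gives disjointness from earlier cover sets. If [c] codes nothing, [rep a c] is arbitrary
     and the recursion treats it like any other. *)
  apply (almost_disjoint_of_data K K_inf K_pow X HX lt wf tr tot small x U0 U0_small hull Hhull
    (fun a y => C a y \/ E a y)) with (E := E) (E' := E') (code := code)
    (rep := fun a c => epsilon (inhabits (fun _ => True)) (fun f => code a f = c)).
  - intros a. apply clopen_or; [apply HC|apply HE].
  - intros a [H|H]; [now apply (Cx a)|]. now apply (proj1 (proj2 (proj2 (HE a)))).
  - apply HE.
  - auto.
  - intros a y Ey. now apply (proj2 (proj2 (proj2 (HE a)))).
  - intros a b y ba Ey. apply (proj2 (proj2 (proj2 (HE a)))) in Ey.
    destruct Ey as [_ [_ H]]. apply H in ba. tauto.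
  - intros a c. apply HE'.
  - intros a c. apply HE'.
  - intros a c. apply HE'.
  - exact Hcode.
  - intros a f. apply (epsilon_spec _ (fun g => code a g = code a f)). now exists f.
  - intros y yx. destruct (Ccover y yx) as [a Ca]. exists a. auto.
  - intros a c. apply HE'.
Qed.

(** * Passing to the remainder *)

Section StoneCech.
Context (X : Top) (cX : Defs.compact X) (x : X) (B : Top) (e : X -> B)
  (He : stone_cech_of (fun y => y <> x) B e).

(** The indicator of [W] extends to a continuous [g] on [B]. Were [g] equal to 1/2 somewhere,
    density would give an image point with value strictly between 1/3 and 2/3, where [g] is 0 or 1.
    So the set where [g] exceeds 1/2 is clopen. *)
Lemma clopen_extension (W : X -> Prop) :
  isopen W -> isopen (fun y => y <> x /\ ~ W y) ->
  exists V, isclopen V /\ forall y, y <> x -> (V (e y) <-> W y).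
Proof.
  intros HW HW'. destruct He as [_ [_ [[inj [_ emb]] [dense star]]]].
  destruct (emb W HW) as [V [HV WV]]. destruct (emb _ HW') as [V' [HV' WV']].
  destruct (star (indicator V)) as [g [Hg gE]].
  - apply indicator_bounded.
  - apply indicator_rcont with V V'; auto; [tauto|].
    intros b [y [yx <-]]. specialize (WV y yx); specialize (WV' y yx). tauto.
  - assert (g01 : forall b, ~ (g b < 1/2) <-> g b > 1/2).
    { intros b. split; [|lra]. intros Hb.
      destruct (Rtotal_order (g b) (1/2)) as [H|[H|H]]; [tauto| |exact H].
      destruct (dense (fun b => g b > 1/3 /\ g b < 2/3)) as [y [yx Hy]].
      - apply open_inter; [apply (rcont_preimage g (fun r => r > 1/3))|
          apply (rcont_preimage g (fun r => r < 2/3))]; auto using Ropen_gt, Ropen_lt.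
      - exists b. lra.
      - rewrite gE in Hy by (now exists y). unfold indicator in Hy.
        destruct excluded_middle_informative; lra. }
    exists (fun b => g b > 1/2). split; [split|].
    + apply (rcont_preimage g (fun r => r > 1/2)); auto using Ropen_gt.
    + apply open_ext with (fun b => g b < 1/2).
      * intros b. rewrite <- g01. split; [tauto|apply NNPP].
      * apply (rcont_preimage g (fun r => r < 1/2)); auto using Ropen_lt.
    + intros y yx. rewrite gE by (now exists y). rewrite (WV y yx).
      unfold indicator. destruct excluded_middle_informative; split; intros; tauto || lra || (exfalso; lra).
Qed.

(** [Z] is compact and misses [x], so [e] is continuous on it, and a compact image in a Hausdorff
    space is closed. *)
Lemma closed_image_of_clopen (Z : X -> Prop) :
  isclopen Z -> ~ Z x -> isclosed (image_of Z e).
Proof.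
  intros HZ Zx. destruct He as [_ [hB [[_ [cont _]] _]]].
  apply open_local. intros b Nb.
  (* [p z] pairs a neighbourhood of [z] with a neighbourhood of [b] that avoids the image of the
     former. *)
  destruct (choice (fun (z : {z | Z z}) (p : (X -> Prop) * (B -> Prop)) =>
     isopen (fst p) /\ isopen (snd p) /\ fst p (proj1_sig z) /\ snd p b /\
     forall y, y <> x -> fst p y -> ~ snd p (e y))) as [p Hp].
  { intros [z Zz]. simpl.
    destruct (hB (e z) b) as [U [V [HU [HV [Uz [Vb UV]]]]]].
    - intros Ezb. apply Nb. now exists z.
    - destruct (cont U HU) as [U' [HU' UU']]. exists (U', V). simpl.
      split; [exact HU'|split; [exact HV|split; [|split; [exact Vb|]]]].
      + apply UU'; auto. now intros ->.
      + intros y yx Uy Vy. apply (UV (e y)); auto. now apply UU'. }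
  destruct (cX (option {z | Z z}) (fun o y => match o with None => ~ Z y | Some z => fst (p z) y end))
    as [l Hl].
  - intros [z|]; [apply Hp|apply HZ].
  - intros y. destruct (classic (Z y)) as [Zy|Zy]; [|now exists None].
    exists (Some (exist _ y Zy)). apply (Hp (exist _ y Zy)).
  - exists (fun b' => forall o, In o l -> match o with None => True | Some z => snd (p z) b' end).
    split; [|split].
    + apply (open_list_and _ (fun o b' => match o with None => True | Some z => snd (p z) b' end)).
      intros [z|]; [apply Hp|apply open_full].
    + intros [z|] _; [apply Hp|exact I].
    + intros b' Hb' [y [Zy <-]]. destruct (Hl y) as [[z|] [Hz Hy]]; [|tauto].
      specialize (Hb' _ Hz). simpl in Hb'. revert Hb'. apply Hp; auto. now intros ->.
Qed.

End StoneCech.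

Theorem theorem7p5 :
  forall (K : Type),
    card_le nat K ->
    kappa_eq_kappa_lt_kappa K ->
    forall (S : Top), kappa_Parovicenko K S -> weight_is K S ->
    forall (x : S) (B : Top) (e : S -> B),
      stone_cech_of (fun y => y <> x) B e ->
      exists F : (K -> Prop) -> (B -> Prop),
        (forall P, clopen_in (remainder (fun y => y <> x) e) (F P) /\ exists b, F P b) /\
        (forall P Q, P <> Q -> forall b, F P b -> F Q b -> False).
Proof.
  intros K K_inf K_pow S HS [base _] x B e He.
  destruct (almost_disjoint_clopen_family K S x K_inf K_pow HS base) as [W [Wopen [Wunb Wad]]].
  pose proof (proj1 HS) as cS. pose proof (proj1 (proj2 (proj2 HS))) as zS.
  destruct (choice (fun P V => isclopen V /\ forall y, y <> x -> (V (e y) <-> W P y))) as [V HV].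
  { intros P. apply clopen_extension; auto; apply Wopen. }
  exists (fun P b => remainder (fun y => y <> x) e b /\ V P b). split.
  - intros P. destruct (HV P) as [[VO VC] VW]. split.
    + split; [tauto|split; [exists (V P)|exists (fun b => ~ V P b)]; split; auto; tauto].
    (* If [V P] lay inside the image, compactness would cover it by the traces of finitely many
       clopen sets missing [x]. Their union would contain [W P], which accumulates at [x]. *)
    + apply NNPP; intros N.
      assert (Himg : forall b, V P b -> exists y, y <> x /\ e y = b).
      { intros b Vb. apply NNPP; intros Nb. apply N. exists b. now split. }
      pose (D := fun Z : {Z : S -> Prop | isclopen Z /\ ~ Z x} => proj1_sig Z).
      destruct (choice (fun (Z : {Z : S -> Prop | isclopen Z /\ ~ Z x}) O =>
        isopen O /\ forall y, y <> x -> (D Z y <-> O (e y)))) as [O HO].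
      { intros [Z [HZ Zx]]. apply He, HZ. }
      destruct (proj1 He (option {Z : S -> Prop | isclopen Z /\ ~ Z x})
        (fun o b => match o with None => ~ V P b | Some Z => O Z b end)) as [l Hl].
      * intros [Z|]; [apply HO|exact VC].
      * intros b. destruct (classic (V P b)) as [Vb|Vb]; [|now exists None].
        destruct (Himg b Vb) as [y [yx <-]].
        destruct (zero_dimensional_clopen (fun y => y <> x) y zS) as [Z [HZ [Zy Zx]]]; auto.
        { eapply open_neq; eauto. }
        assert (H : isclopen Z /\ ~ Z x) by (split; [exact HZ|intros H; now apply (Zx x)]).
        exists (Some (exist _ Z H)). now apply HO.
      * destruct (Wunb P (fun y => exists o, In o l /\
          match o with None => False | Some Z => D Z y end)) as [y [Wy [yx Ny]]].
        -- apply (clopen_list_or _ (fun o y => match o with None => False | Some Z => D Z y end)).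
           intros [[Z HZ]|]; [apply HZ|apply clopen_empty].
        -- intros [[[Z HZ]|] [_ H]]; [now apply HZ|exact H].
        -- destruct (Hl (e y)) as [[Z|] [HZ Hy]].
           ++ apply Ny. exists (Some Z). split; [exact HZ|]. now apply HO.
           ++ apply Hy. now apply VW.
  - intros P Q PQ b [Rb Pb] [_ Qb].
    destruct (Wad P Q PQ) as [Z [HZ [Zx WZ]]].
    pose proof (proj1 (proj2 (proj2 (proj2 He)))) as dense.
    (* A common remainder point lies outside the closed image of [Z], so by density some [y] outside
       [Z] belongs to both [W P] and [W Q], which is impossible. *)
    destruct (dense (fun b => (V P b /\ V Q b) /\ ~ image_of Z e b)) as [y [yx [[Py Qy] Zy]]].
    + apply open_inter; [apply open_inter; apply HV|]. eapply closed_image_of_clopen; eauto.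
    + exists b. split; [auto|]. intros [y [Zy <-]]. apply Rb. exists y. split; [|reflexivity].
      now intros ->.
    + apply Zy. exists y. split; [|reflexivity]. apply WZ; apply HV; auto.
Qed.
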